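(* Consider a connected first order circuit with a chosen reference node, containing no loops composed only of voltage sources and no cutsets composed only of current sources, and its time-invariant nodal model, i.e. the semiexplicit differential-algebraic system in the dynamic variables $x=(q_c,q_{mc},\varphi_l,\varphi_{ml},q_m,q_{ml},q_{hm},q_{hw},\varphi_w,\varphi_{mc},\varphi_{hm},\varphi_{hw})$ and the algebraic variables $y=(e,i_c,i_{mc},i_u,i_l,i_{ml},i_r,i_m,i_{hm},i_{hw})$ written out in the context. Assume that the (incremental) capacitance matrix $C$, memcapacitance matrix $C_{\mathrm m}$, inductance matrix $L$, meminductance matrix $L_{\mathrm m}$, resistance matrix $R$, conductance matrix $G$, memristance matrix $M$, hybrid memristance matrix $M_{\mathrm h}$, memductance matrix $W$ and hybrid memductance matrix $W_{\mathrm h}$ are positive definite (not necessarily symmetric), at all values of their arguments. If the circuit has topologically degenerate configurations, that is, if it contains at least one loop composed only of voltage sources, capacitors and/or memcapacitors, or at least one cutset composed only of current sources, inductors and/or meminductors, then the nodal model has tractability index two.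
   Context: **Circuit and incidence matrix.** A circuit is a connected directed graph whose branches are the devices; a reference node is chosen. The reduced incidence matrix $A=(a_{kj})$ has one row per non-reference node and one column per branch, with $a_{kj}=1$ if branch $j$ leaves node $k$, $a_{kj}=-1$ if branch $j$ enters node $k$, and $a_{kj}=0$ if branch $j$ is not incident with node $k$. Branch currents $i$ and voltages $v$ satisfy Kirchhoff's laws $Ai=0$, $v=A^Te$, where $e$ is the vector of node potentials. The columns of $A$ are partitioned according to device type, giving submatrices $A_c,A_l,A_r,A_g,A_m,A_w,A_{mc},A_{ml},A_{hm},A_{hw},A_u,A_j$, and vectors of variables carry the same subscripts. Every branch of the circuit belongs to one of these types (any type may be absent). Loops are cycles of the graph, ignoring orientation; cutsets are minimal sets of branches whose removal disconnects the connected graph. **Devices** ($q$ = charge, $\varphi$ = flux; $q'=i$ and $\varphi'=v$ for each branch). All maps below are $C^1$ and time-invariant, defined on the whole corresponding real spaces, and vector-valued (one map for all the devices of a given type, so full coupling within each type is allowed): - $c$: capacitors, $q_c=\gamma_c(v_c)$; - $l$: inductors, $\varphi_l=\gamma_l(i_l)$; - $r$: current-controlled resistors, $v_r=\gamma_r(i_r)$; - $g$: voltage-controlled resistors, $i_g=\gamma_g(v_g)$; - $m$: $q$-memristors, $v_m=\eta(q_m,i_m)$; - $w$: $\varphi$-memristors, $i_w=\zeta(\varphi_w,v_w)$; - $mc$: voltage-controlled memcapacitors, $q_{mc}=\omega(\varphi_{mc},v_{mc})$; - $ml$: current-controlled meminductors, $\varphi_{ml}=\theta(q_{ml},i_{ml})$;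 - $hm$: current-controlled hybrid memristors, $v_{hm}=\psi(q_{hm},\varphi_{hm},i_{hm})$; - $hw$: voltage-controlled hybrid memristors, $i_{hw}=\xi(q_{hw},\varphi_{hw},v_{hw})$; - $u$: voltage sources, $v_u=v_s(t)$; - $j$: current sources, $i_j=i_s(t)$, with $v_s,i_s$ of class $C^1$. By definition of these devices, none of the partial derivatives of the scalar maps $\eta,\zeta,\omega,\theta,\psi,\xi$ with respect to each of its arguments vanishes identically (for coupled devices this requirement is replaced by non-singularity of the corresponding matrices of partial derivatives). **Incremental matrices.** $R=\gamma_r'$, $G=\gamma_g'$, $C=\gamma_c'$, $L=\gamma_l'$, $M=\partial\eta/\partial i_m$, $W=\partial\zeta/\partial v_w$, $C_{\mathrm m}=\partial\omega/\partial v_{mc}$, $L_{\mathrm m}=\partial\theta/\partial i_{ml}$, $M_{\mathrm h}=\partial\psi/\partial i_{hm}$, $W_{\mathrm h}=\partial\xi/\partial v_{hw}$. They need not be diagonal or symmetric. A square real matrix $K$ is positive definite if $u^TKu>0$ for every nonzero real vector $u$; symmetry is not required. **Nodal model.** The differential equations are $$q_c'=i_c,\quad q_{mc}'=i_{mc},\quad \varphi_l'=A_l^Te,\quad \varphi_{ml}'=A_{ml}^Te,\quad q_m'=i_m,\quad q_{ml}'=i_{ml},$$ $$q_{hm}'=i_{hm},\quad q_{hw}'=i_{hw},\quad \varphi_w'=A_w^Te,\quad \varphi_{mc}'=A_{mc}^Te,\quad \varphi_{hm}'=A_{hm}^Te,\quad \varphi_{hw}'=A_{hw}^Te,$$ and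 the algebraic equations are $$0=A_ci_c+A_{mc}i_{mc}+A_ui_u+A_li_l+A_{ml}i_{ml}+A_g\gamma_g(A_g^Te)+A_w\zeta(\varphi_w,A_w^Te)+A_ri_r+A_mi_m+A_{hm}i_{hm}+A_{hw}i_{hw}+A_ji_s(t),$$ $$0=q_c-\gamma_c(A_c^Te),\quad 0=q_{mc}-\omega(\varphi_{mc},A_{mc}^Te),\quad 0=v_s(t)-A_u^Te,\quad 0=\varphi_l-\gamma_l(i_l),\quad 0=\varphi_{ml}-\theta(q_{ml},i_{ml}),$$ $$0=\gamma_r(i_r)-A_r^Te,\quad 0=\eta(q_m,i_m)-A_m^Te,\quad 0=\psi(q_{hm},\varphi_{hm},i_{hm})-A_{hm}^Te,\quad 0=i_{hw}-\xi(q_{hw},\varphi_{hw},A_{hw}^Te).$$ **Tractability index.** Write the nodal model as $Ez'=f(z,t)$ with $z=(x,y)$ and $E=\mathrm{block\text{-}diag}\{I,0\}$, where the identity block $I$ corresponds to the dynamic variables $x$. Let $F=f_z$ be the matrix of partial derivatives of the right-hand side with respect to $z$ (here it depends on $z$ only), and let $Q$ be a projector onto $\ker E$, e.g. $Q=\mathrm{block\text{-}diag}\{0,I\}$. Set $E_1=E-FQ$. The problem has tractability index one if $E_1$ is non-singular. It has tractability index two if $E_1$ is singular (at every $z$), there is a projector $Q_1=Q_1(z)$ onto $\ker E_1(z)$ depending continuously on $z$, and, with $F_1=F(I-Q)$, the matrix $E_2=E_1-F_1Q_1$ is non-singular (at every $z$). *)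

(* Defs.v *)
From HB Require Import structures.
From mathcomp Require Import all_boot all_order all_algebra.
From mathcomp Require Import all_classical all_reals all_analysis.
Set Implicit Arguments.
Unset Strict Implicit.
Unset Printing Implicit Defensive.
Import Order.TTheory GRing.Theory Num.Theory.
Import numFieldNormedType.Exports.
Local Open Scope classical_set_scope.
Local Open Scope ring_scope.

Section Calculus.
Variable R : realType.

(* In finite dimension, continuity of every directional derivative of a
   differentiable map is continuity of its differential. *)
Definition C1 (V W : normedModType R) (f : V -> W) : Prop :=
  (forall x, differentiable f x) /\ (forall v, continuous (fun x => 'D_v f x)).

(* The library's [jacobian] acts on row vectors, on the right; this is the
   usual matrix of partial derivatives, acting on column vectors. *)
Definition jac m n (f : 'cV[R]_n -> 'cV[R]_m) (x : 'cV[R]_n) : 'M[R]_(m, n) :=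
  \matrix_(i, j) ('D_(delta_mx j 0) f x) i 0.

Definition posdef n (K : 'M[R]_n) : Prop :=
  forall u : 'cV[R]_n, u != 0 -> 0 < (u^T *m K *m u) 0 0.

Definition projector_onto_ker n (K P : 'M[R]_n) : Prop :=
  P *m P = P /\
  forall v : 'cV[R]_n, K *m v = 0 <-> exists w : 'cV[R]_n, v = P *m w.

(* For a problem E z' = f(z, t) whose partial derivative F = f_z does not
   depend on t, so that Q1 is a function of z only. The projector Q onto
   ker E is arbitrary. *)
Definition tractability_index_two n (E : 'M[R]_n)
    (f : 'cV[R]_n -> R -> 'cV[R]_n) : Prop :=
  forall Q : 'M[R]_n, projector_onto_ker E Q ->
  let F z t := jac (fun z' => f z' t) z in
  let E1 z t := E - F z t *m Q in
  let F1 z t := F z t *m (1%:M - Q) in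
  (forall z t, E1 z t \notin unitmx) /\
  exists Q1 : 'cV[R]_n -> 'M[R]_n,
    [/\ continuous Q1,
        forall z t, projector_onto_ker (E1 z t) (Q1 z)
      & forall z t, E1 z t - F1 z t *m Q1 z \in unitmx].

End Calculus.

(* Device types, named by their subscripts; for instance [Kr] and [Kg] are the
   current- and voltage-controlled resistors, [Ku] and [Kj] the voltage and
   current sources. *)
Inductive kind := Kc | Kl | Kr | Kg | Km | Kw | Kmc | Kml | Khm | Khw | Ku | Kj.

Definition kind_code (k : kind) : nat :=
  match k with
  | Kc => 0 | Kl => 1 | Kr => 2 | Kg => 3 | Km => 4 | Kw => 5
  | Kmc => 6 | Kml => 7 | Khm => 8 | Khw => 9 | Ku => 10 | Kj => 11
  end.

Lemma kind_code_inj : injective kind_code.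
Proof. by do 2!case. Qed.

HB.instance Definition _ := Equality.copy kind (inj_type kind_code_inj).

(* A directed multigraph with a reference node and typed branches: branch [j]
   leaves node [src j] and enters node [dst j]. *)
Record network := Network {
  nnodes : nat;
  nbranches : nat;
  ref : 'I_nnodes.+1;
  src : 'I_nbranches -> 'I_nnodes.+1;
  dst : 'I_nbranches -> 'I_nnodes.+1;
  type_of : 'I_nbranches -> kind
}.

Section Graph.
Variable G : network.
Local Notation node := 'I_(nnodes G).+1.
Local Notation branch := 'I_(nbranches G).

Definition joins (j : branch) (x y : node) : bool :=
  ((src j == x) && (dst j == y)) || ((src j == y) && (dst j == x)).

Definition connected_by (S : {set branch}) : bool :=
  [forall x : node, forall y : node,
     connect (fun x y => [exists j in S, joins j x y]) x y].

Definition connected_network : bool := connected_by [set: branch].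

(* The pairs are the successive nodes of the cycle, each with the branch
   joining it to the next one; branches must be distinct too, which matters
   only for cycles of length two. *)
Definition is_loop (S : {set branch}) : Prop :=
  exists s : seq (node * branch),
    [/\ s != [::], uniq (unzip1 s), uniq (unzip2 s),
        cycle (fun p q => joins p.2 p.1 q.1) s
      & S = [set j in unzip2 s]].

Definition is_cutset (S : {set branch}) : bool :=
  minset (fun S => ~~ connected_by (~: S)) S.

Definition only_kinds (ks : seq kind) (S : {set branch}) : Prop :=
  forall j, j \in S -> type_of j \in ks.

Definition has_loop (ks : seq kind) : Prop :=
  exists S, is_loop S /\ only_kinds ks S.

Definition has_cutset (ks : seq kind) : Prop :=
  exists S, is_cutset S /\ only_kinds ks S.

Definition branches_of (k : kind) : {set branch} := [set j | type_of j == k].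

Definition nb (k : kind) : nat := #|branches_of k|.

(* Row [i] is that of the non-reference node [lift (ref G) i]; a branch with
   [src j = dst j] has a zero column. *)
Definition incidence (R : realType) : 'M[R]_(nnodes G, nbranches G) :=
  \matrix_(i, j) ((src j == lift (ref G) i)%:R - (dst j == lift (ref G) i)%:R).

Definition incidence_of (R : realType) (k : kind) : 'M[R]_(nnodes G, nb k) :=
  colsub (fun j : 'I_(nb k) => enum_val j) (incidence R).

End Graph.

Record devices (R : realType) (G : network) := Devices {
  gamma_c : 'cV[R]_(nb G Kc) -> 'cV[R]_(nb G Kc);
  gamma_l : 'cV[R]_(nb G Kl) -> 'cV[R]_(nb G Kl);
  gamma_r : 'cV[R]_(nb G Kr) -> 'cV[R]_(nb G Kr);
  gamma_g : 'cV[R]_(nb G Kg) -> 'cV[R]_(nb G Kg);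
  eta : 'cV[R]_(nb G Km) * 'cV[R]_(nb G Km) -> 'cV[R]_(nb G Km);
  zeta : 'cV[R]_(nb G Kw) * 'cV[R]_(nb G Kw) -> 'cV[R]_(nb G Kw);
  omega : 'cV[R]_(nb G Kmc) * 'cV[R]_(nb G Kmc) -> 'cV[R]_(nb G Kmc);
  theta : 'cV[R]_(nb G Kml) * 'cV[R]_(nb G Kml) -> 'cV[R]_(nb G Kml);
  psi : 'cV[R]_(nb G Khm) * 'cV[R]_(nb G Khm) * 'cV[R]_(nb G Khm) ->
        'cV[R]_(nb G Khm);
  xi : 'cV[R]_(nb G Khw) * 'cV[R]_(nb G Khw) * 'cV[R]_(nb G Khw) ->
       'cV[R]_(nb G Khw);
  v_s : R -> 'cV[R]_(nb G Ku);
  i_s : R -> 'cV[R]_(nb G Kj)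
}.

Section Devices.
Variables (R : realType) (G : network) (D : devices R G).

Definition smooth_devices : Prop :=
  [/\ [/\ C1 (gamma_c D), C1 (gamma_l D), C1 (gamma_r D) & C1 (gamma_g D)],
      [/\ C1 (eta D), C1 (zeta D), C1 (omega D) & C1 (theta D)],
      C1 (psi D) /\ C1 (xi D)
    & C1 (v_s D) /\ C1 (i_s D)].

(* Partial derivatives with respect to the last argument, at [p]. *)
Definition dlast (T : Type) n (h : T * 'cV[R]_n -> 'cV[R]_n) p : 'M[R]_n :=
  jac (fun u => h (p.1, u)) p.2.

Definition Cmat := jac (gamma_c D).
Definition Lmat := jac (gamma_l D).
Definition Rmat := jac (gamma_r D).
Definition Gmat := jac (gamma_g D).
Definition Mmat := dlast (eta D).
Definition Wmat := dlast (zeta D).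
Definition Cm_mat := dlast (omega D).
Definition Lm_mat := dlast (theta D).
Definition Mh_mat := dlast (psi D).
Definition Wh_mat := dlast (xi D).

(* For a single device this says that no partial derivative vanishes
   identically. For uncoupled devices the matrices are diagonal, and
   non-singularity at some point says the same of every device. For coupled
   devices it is the weakest form of the non-singularity requirement. *)
Definition depends2 n (h : 'cV[R]_n * 'cV[R]_n -> 'cV[R]_n) : Prop :=
  (exists p, jac (fun a => h (a, p.2)) p.1 \in unitmx) /\
  (exists p, dlast h p \in unitmx).

Definition depends3 n (h : 'cV[R]_n * 'cV[R]_n * 'cV[R]_n -> 'cV[R]_n) : Prop :=
  [/\ exists p, jac (fun a => h (a, p.1.2, p.2)) p.1.1 \in unitmx,
      exists p, jac (fun b => h (p.1.1, b, p.2)) p.1.2 \in unitmx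
    & exists p, dlast h p \in unitmx].

Definition genuine_devices : Prop :=
  [/\ [/\ depends2 (eta D), depends2 (zeta D), depends2 (omega D)
        & depends2 (theta D)],
      depends3 (psi D) & depends3 (xi D)].

(* (q_c, q_mc, phi_l, phi_ml, q_m, q_ml, q_hm, q_hw, phi_w, phi_mc, phi_hm,
   phi_hw) *)
Definition nx : nat :=
  (nb G Kc + (nb G Kmc + (nb G Kl + (nb G Kml + (nb G Km + (nb G Kml +
  (nb G Khm + (nb G Khw + (nb G Kw + (nb G Kmc + (nb G Khm +
   nb G Khw)))))))))))%N.

(* (e, i_c, i_mc, i_u, i_l, i_ml, i_r, i_m, i_hm, i_hw) *)
Definition ny : nat :=
  (nnodes G + (nb G Kc + (nb G Kmc + (nb G Ku + (nb G Kl + (nb G Kml +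
  (nb G Kr + (nb G Km + (nb G Khm + nb G Khw)))))))))%N.

Definition nodal_E : 'M[R]_(nx + ny) := block_mx 1%:M 0 0 0.

Definition nodal_rhs (z : 'cV[R]_(nx + ny)) (t : R) : 'cV[R]_(nx + ny) :=
  let A := incidence_of G R in
  let x := usubmx z in
  let q_c := usubmx x in let x1 := dsubmx x in
  let q_mc := usubmx x1 in let x2 := dsubmx x1 in
  let phi_l := usubmx x2 in let x3 := dsubmx x2 in
  let phi_ml := usubmx x3 in let x4 := dsubmx x3 in
  let q_m := usubmx x4 in let x5 := dsubmx x4 in
  let q_ml := usubmx x5 in let x6 := dsubmx x5 in
  let q_hm := usubmx x6 in let x7 := dsubmx x6 in
  let q_hw := usubmx x7 in let x8 := dsubmx x7 in
  let phi_w := usubmx x8 in let x9 := dsubmx x8 in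
  let phi_mc := usubmx x9 in let x10 := dsubmx x9 in
  let phi_hm := usubmx x10 in
  let phi_hw := dsubmx x10 in
  let y := dsubmx z in
  let e := usubmx y in let y1 := dsubmx y in
  let i_c := usubmx y1 in let y2 := dsubmx y1 in
  let i_mc := usubmx y2 in let y3 := dsubmx y2 in
  let i_u := usubmx y3 in let y4 := dsubmx y3 in
  let i_l := usubmx y4 in let y5 := dsubmx y4 in
  let i_ml := usubmx y5 in let y6 := dsubmx y5 in
  let i_r := usubmx y6 in let y7 := dsubmx y6 in
  let i_m := usubmx y7 in let y8 := dsubmx y7 in
  let i_hm := usubmx y8 in
  let i_hw := dsubmx y8 in
  let v k := (A k)^T *m e in
  let fx : 'cV[R]_nx :=
    col_mx i_c (col_mx i_mc (col_mx (v Kl) (col_mx (v Kml)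
   (col_mx i_m (col_mx i_ml (col_mx i_hm (col_mx i_hw
   (col_mx (v Kw) (col_mx (v Kmc) (col_mx (v Khm) (v Khw))))))))))) in
  let fy : 'cV[R]_ny :=
    col_mx (A Kc *m i_c + A Kmc *m i_mc + A Ku *m i_u + A Kl *m i_l
            + A Kml *m i_ml + A Kg *m gamma_g D (v Kg)
            + A Kw *m zeta D (phi_w, v Kw) + A Kr *m i_r + A Km *m i_m
            + A Khm *m i_hm + A Khw *m i_hw + A Kj *m i_s D t)
   (col_mx (q_c - gamma_c D (v Kc))
   (col_mx (q_mc - omega D (phi_mc, v Kmc))
   (col_mx (v_s D t - v Ku)
   (col_mx (phi_l - gamma_l D i_l)
   (col_mx (phi_ml - theta D (q_ml, i_ml))
   (col_mx (gamma_r D i_r - v Kr)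
   (col_mx (eta D (q_m, i_m) - v Km)
   (col_mx (psi D (q_hm, phi_hm, i_hm) - v Khm)
           (i_hw - xi D (q_hw, phi_hw, v Khw)))))))))) in
  col_mx fx fy.

End Devices.

(* Main.v *)
From HB Require Import structures.
Require Import Defs.
From mathcomp Require Import all_boot all_order all_algebra.
From mathcomp Require Import all_classical all_reals all_analysis.
From mathcomp Require Import lra.
Set Implicit Arguments.
Unset Strict Implicit.
Unset Printing Implicit Defensive.
Import Order.TTheory GRing.Theory Num.Theory.
Import numFieldNormedType.Exports.
Local Open Scope ring_scope.

(** Differentiating the nodal model gives the nodal model of a linear circuit
    on the same graph, whose devices are the differentials of the original ones
    and whose sources are switched off ([linearized_rhs]). Positive definiteness
    of the incremental matrices turns into strict passivity of these linear
    devices ([linearized_passive]). So the index can be read off from linear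
    circuits with strictly passive devices, by energy arguments.

    Write Fxy, Fyx, Fyy for the blocks of F. For the projector with blocks
    0 and I the kernel of E1 is the set of (Fxy y, y) with Fyy y = 0, and the
    range of E1 consists of the vectors whose algebraic part lies in the range
    of Fyy. The block Fxy does not depend on the operating point. If ker Fyy
    does not depend on it either, then neither does ker E1, and a constant
    projector Q1 will do; the problem has index two as soon as ker Fyy is
    nonzero and Fyx Fxy maps no nonzero vector of ker Fyy into the range of Fyy.
    [semiexplicit_index_two] proves this, for every choice of the projector Q.

    The three conditions on Fyy hold for the following reasons, where capacitors
    include memcapacitors and inductors include meminductors.

    - In a vector of ker Fyy, the capacitive and source voltages and the
      inductive currents vanish. By Tellegen's theorem the power absorbed by
      the remaining devices is zero, so by passivity they are all at rest. What
      is left, a current circulating in the capacitors and voltage sources and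
      a potential that only jumps across inductors and current
      sources, is unconstrained by the devices; this describes ker Fyy by the
      incidence matrix alone ([algebraic_kernel]).
    - A loop of voltage sources and capacitors carries such a current, and the
      indicator of one side of a cutset of current sources and inductors is
      such a potential, so ker Fyy is nonzero ([degenerate_kernel]).
    - If Fyx Fxy y = Fyy u with y in ker Fyy, then the circulating currents of y
      are those drawn by the capacitors under the potential of u, and
      orthogonality of currents and voltages kills them; the current left in the
      voltage sources vanishes because these contain no loop. The dual argument
      kills the inductor voltages, and then the potential, because the
      current sources contain no cutset ([transversality]).

    The graph theory needed is that nonzero circulations contain loops and
    conversely ([loop_of_circulation], [circulation_of_loop]), and the
    analogous facts for potentials and cutsets ([cutset_of_potential],
    [potential_of_cutset]). *)

(** * A criterion for tractability index two *)

Lemma unitmx_kernel (F : fieldType) n (K : 'M[F]_n) :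
  (forall v : 'cV_n, K *m v = 0 -> v = 0) -> K \in unitmx.
Proof.
move=> K_inj; rewrite -unitmx_tr -row_free_unit -kermx_eq0; apply/eqP.
apply/row_matrixP => i; rewrite row0; apply: trmx_inj; rewrite trmx0; apply: K_inj.
by apply: trmx_inj; rewrite trmx_mul trmxK -row_mul mulmx_ker row0 trmx0.
Qed.

(** Applied to [K] at one operating point, this gives a single projector for all
    operating points at which the kernel is the same. *)
Lemma projector_pinvmx (R : realType) n (K : 'M[R]_n) :
  projector_onto_ker K (1%:M - pinvmx K *m K).
Proof.
have KP : K *m (1%:M - pinvmx K *m K) = 0.
  by rewrite mulmxBr mulmx1 mulmxA mulmxKpV ?subrr.
split; first by rewrite {1}mulmxBl mul1mx -[X in _ - X]mulmxA KP mulmx0 subr0.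
move=> v; split=> [Kv0|[w ->]]; last by rewrite mulmxA KP mul0mx.
by exists v; rewrite mulmxBl mul1mx -mulmxA Kv0 mulmx0 subr0.
Qed.

(** A projector Q onto ker E has range in the algebraic part, and E1 v depends
    on v only through its dynamic part and through Q v. Hence v is in ker E1
    exactly when the dynamic part of v is Fxy (Q v) and Fyy (Q v) = 0, whatever
    the operating point. If E2 v = 0, then w := Q1 v is in ker E1, and F1 w is
    in the range of E1; the last hypothesis, applied to Q w, gives w = 0. Then
    v is in ker E1 = im Q1, so that v = Q1 v = w = 0. *)
Lemma semiexplicit_index_two (R : realType) n m
    (f : 'cV[R]_(n + m) -> R -> 'cV[R]_(n + m))
    (df : 'cV[R]_(n + m) -> R -> 'cV[R]_(n + m) -> 'cV[R]_(n + m)) :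
  let dxy z t y := usubmx (df z t (col_mx 0 y)) in
  let dyy z t y := dsubmx (df z t (col_mx 0 y)) in
  let dyx z t x := dsubmx (df z t (col_mx x 0)) in
  (forall z t w, jac (fun z' => f z' t) z *m w = df z t w) ->
  (forall z t z' t' y, dxy z t y = dxy z' t' y) ->
  (forall z t z' t' y, dyy z t y = 0 -> dyy z' t' y = 0) ->
  (exists2 y, y != 0 & dyy 0 0 y = 0) ->
  (forall z t y u, dyy z t y = 0 -> dyx z t (dxy z t y) = dyy z t u -> y = 0) ->
  tractability_index_two (block_mx 1%:M 0 0 0) f.
Proof.
set F := fun z t => jac (fun z' => f z' t) z => dxy dyy dyx dfE.
pose Fxy z t (y : 'cV[R]_m) := usubmx (F z t *m col_mx 0 y).
pose Fyy z t (y : 'cV[R]_m) := dsubmx (F z t *m col_mx 0 y).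
pose Fyx z t (x : 'cV[R]_n) := dsubmx (F z t *m col_mx x 0).
have [-> -> ->] : [/\ dxy = Fxy, dyy = Fyy & dyx = Fyx].
  by split; do 3![apply: funext => ?]; rewrite /Fxy /Fyy /Fyx dfE.
move=> Fxy_const Fyy_ker [y0 y0_neq0 Fyy_y0] transversal Q [QQ kerQ] /=.
set E : 'M[R]_(n + m) := block_mx 1%:M 0 0 0.
pose E1 z t := E - F z t *m Q.
rewrite -/F.
have EE (v : 'cV_(n + m)) : E *m v = col_mx (usubmx v) 0.
  by rewrite -[v in LHS]vsubmxK mul_block_col !mul0mx mul1mx !addr0.
have Qid (v : 'cV_(n + m)) : usubmx v = 0 -> Q *m v = v.
  move=> v0; have /kerQ[w ->] : E *m v = 0 by rewrite EE v0 col_mx0.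
  by rewrite mulmxA QQ.
have Qv (v : 'cV_(n + m)) : Q *m v = col_mx 0 (dsubmx (Q *m v)).
  have := (kerQ (Q *m v)).2 (ex_intro _ v erefl).
  rewrite EE => /(congr1 usubmx); rewrite col_mxKu linear0 => Qv0.
  by rewrite -[LHS]vsubmxK Qv0.
have E1E z t (v : 'cV_(n + m)) : E1 z t *m v =
    col_mx (usubmx v - Fxy z t (dsubmx (Q *m v))) (- Fyy z t (dsubmx (Q *m v))).
  rewrite mulmxBl EE -mulmxA Qv /Fxy /Fyy; set w := dsubmx _.
  by rewrite -[F z t *m _ in LHS]vsubmxK opp_col_mx add_col_mx add0r col_mxKd.
have E1_ker z t (v : 'cV_(n + m)) : E1 z t *m v = 0 <->
    usubmx v = Fxy z t (dsubmx (Q *m v)) /\ Fyy z t (dsubmx (Q *m v)) = 0.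
  rewrite E1E; split=> [|[-> ->]]; last by rewrite subrr oppr0 col_mx0.
  rewrite -(col_mx0 R n m 1) => /eq_col_mx[/subr0_eq -> /eqP].
  by rewrite oppr_eq0 => /eqP.
have E1_const z t z' t' (v : 'cV_(n + m)) : E1 z t *m v = 0 -> E1 z' t' *m v = 0.
  case/E1_ker=> vx vy; apply/E1_ker; split; last exact: Fyy_ker vy.
  by rewrite vx; apply: Fxy_const.
split=> [z t|].
  (* The element of ker E1 whose image under Q is [col_mx 0 y0]. *)
  pose v := col_mx (Fxy z t y0) 0 - Q *m col_mx (Fxy z t y0) 0 + col_mx 0 y0.
  have Qvy : Q *m v = col_mx 0 y0.
    by rewrite mulmxDr mulmxBr mulmxA QQ subrr add0r Qid ?col_mxKu.
  have E1v : E1 z t *m v = 0.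
    apply/E1_ker; rewrite Qvy col_mxKd; split; last exact: Fyy_ker Fyy_y0.
    rewrite /v Qv opp_col_mx !add_col_mx col_mxKu.
    by rewrite oppr0 !addr0.
  apply: contra_neqN y0_neq0 => E1_unit.
  have v0 : v = 0 by rewrite -[v](mulKmx E1_unit) E1v mulmx0.
  by rewrite -[y0](@col_mxKd _ n _ _ 0) -Qvy v0 mulmx0 linear0.
exists (fun=> 1%:M - pinvmx (E1 0 0) *m E1 0 0); split.
- exact: cst_continuous.
- move=> z t; have [PP kerP] := projector_pinvmx (E1 0 0).
  split; first exact: PP.
  by move=> v; apply: iff_trans (kerP v); split; apply: E1_const.
move=> z t; set Q1 := 1%:M - _.
have [Q1Q1 kerQ1] : projector_onto_ker (E1 0 0) Q1 := projector_pinvmx _.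
apply: unitmx_kernel => v; rewrite mulmxBl => /subr0_eq.
rewrite -/(E1 z t) -!mulmxA; set w := Q1 *m v.
have E1w : E1 z t *m w = 0.
  by apply: (@E1_const 0 0); apply/kerQ1; exists v.
have [wx wy] := (E1_ker z t w).1 E1w.
rewrite [_ *m w]mulmxBl mul1mx => E1v.
have FyyB a b : Fyy z t (a - b) = Fyy z t a - Fyy z t b.
  by rewrite /Fyy -linearB -mulmxBr opp_col_mx add_col_mx subr0.
suff y0' : dsubmx (Q *m w) = 0.
  have w0 : w = 0.
    have Qw : Q *m w = w.
      by apply: Qid; rewrite wx y0' /Fxy col_mx0 mulmx0 linear0.
    by rewrite -Qw Qv y0' col_mx0.
  move: E1v; rewrite w0 mulmx0 subr0 mulmx0 => E1v.
  (* With w = 0 the vector v lies in ker E1, which Q1 fixes. *)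
  have /kerQ1[u vu] := @E1_const z t 0 0 v E1v.
  by rewrite vu -Q1Q1 -mulmxA -vu.
(* The preimage under Fyy read off from the algebraic part of the equation
   E1 v = F (w - Q w), in which the dynamic part of w is Fxy (Q w). *)
apply: (transversal z t _
  (- (dsubmx (Q *m v)) - (dsubmx w - dsubmx (Q *m w))) wy).
rewrite -wx FyyB.
have FyyN a : Fyy z t (- a) = - Fyy z t a.
  by rewrite -[- a]sub0r FyyB {1}/Fyy col_mx0 mulmx0 linear0 sub0r.
rewrite FyyN; have := congr1 dsubmx E1v.
rewrite E1E col_mxKd => ->; apply/eqP; rewrite eq_sym subr_eq; apply/eqP.
rewrite /Fyx /Fyy -linearD -mulmxDr add_col_mx addr0 add0r.
congr (dsubmx (_ *m _)).
by rewrite -{1}[w]vsubmxK {1}Qv opp_col_mx add_col_mx oppr0 addr0.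
Qed.

(** * Directional differentiation of matrix-valued maps *)

Lemma is_derive_mx (R : realType) (V : normedModType R) m n
    (f : V -> 'M[R]_(m, n)) (df : 'M[R]_(m, n)) (z w : V) :
  (forall i j, is_derive z w (fun z' => f z' i j) (df i j)) ->
  is_derive z w f df.
Proof.
move=> f_ij.
have f_der : derivable f z w by apply/derivable_mxP => i j; exact: ex_derive.
apply: DeriveDef => //; rewrite derive_mx //.
by apply/matrixP => i j; rewrite mxE derive_val.
Qed.

Lemma is_derive_coord (R : realType) (V : normedModType R) m n
    (f : V -> 'M[R]_(m, n)) (df : 'M[R]_(m, n)) (z w : V) i j :
  is_derive z w f df -> is_derive z w (fun z' => f z' i j) (df i j).
Proof.
case=> f_der <-; apply: DeriveDef; first by move/derivable_mxP: f_der; apply.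
by rewrite derive_mx // mxE.
Qed.

Lemma is_derive_col_mx (R : realType) (V : normedModType R) m1 m2 n
    (f : V -> 'M[R]_(m1, n)) (g : V -> 'M[R]_(m2, n)) df dg (z w : V) :
  is_derive z w f df -> is_derive z w g dg ->
  is_derive z w (fun z' => col_mx (f z') (g z')) (col_mx df dg).
Proof.
move=> f_der g_der; apply: is_derive_mx => i j.
rewrite mxE; under eq_fun do rewrite mxE.
by case: fintype.split => k; exact: is_derive_coord.
Qed.

Lemma is_derive_mulmx (R : realType) (V : normedModType R) m n p
    (A : 'M[R]_(m, n)) (f : V -> 'M[R]_(n, p)) df (z w : V) :
  is_derive z w f df -> is_derive z w (fun z' => A *m f z') (A *m df).
Proof.
move=> f_der; apply: is_derive_mx => i j; rewrite mxE.
have term_der k : is_derive z w (fun z' => A i k *: f z' k j) (A i k *: df k j).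
  by apply: is_deriveZ; apply: is_derive_coord.
have := is_derive_sum term_der.
by congr is_derive; apply: funext => z'; rewrite mxE fct_sumE.
Qed.

(** The difference quotients of [g \o L] along [w] are those of [g] along
    [L0 w], so the claim reduces to the differentiability of [g]. *)
Lemma is_derive_comp_affine (R : realType) (U V W : normedModType R)
    (L L0 : U -> V) (g : V -> W) (z w : U) :
  (forall h u, L (h *: w + u) = h *: L0 w + L u) -> differentiable g (L z) ->
  is_derive z w (fun z' => g (L z')) ('d g (L z) (L0 w)).
Proof.
move=> L_affine g_diff; rewrite -deriveE //.
split; last by rewrite /derive /=; under eq_fun do rewrite L_affine.
rewrite /derivable /=; under eq_fun do rewrite L_affine.
exact: diff_derivable.
Qed.

(** Gateaux differentiability suffices to compute the matrix of partial
    derivatives. Unlike differentiability, it can be checked entry by entry on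
    block matrices by manipulating directional derivatives only; the linearity
    of [df] is carried along because it cannot be recovered from them. *)
Definition gateaux (R : realType) (U V : normedModType R)
    (f : U -> V) z (df : U -> V) :=
  linear df /\ forall w, is_derive z w f (df w).

Lemma jac_gateaux (R : realType) m n (f : 'cV[R]_n -> 'cV[R]_m) z df :
  gateaux f z df -> forall w, jac f z *m w = df w.
Proof.
case=> df_lin f_der w.
pose df_linear := GRing.isLinear.Build R 'cV[R]_n 'cV[R]_m *:%R df df_lin.
pose dfL : {linear 'cV[R]_n -> 'cV[R]_m} := HB.pack df df_linear.
rewrite -[df w]/(dfL w) {2}[w]matrix_sum_delta linear_sum.
apply/matrixP => i j; rewrite ord1 !mxE summxE; apply: eq_bigr => k _.
rewrite big_ord1 linearZ !mxE mulrC; congr (_ * _).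
by have := f_der (delta_mx k 0) => H; rewrite derive_val.
Qed.

Section Gateaux.
Variables (R : realType) (U : normedModType R) (z : U).

Lemma gateaux_comp_affine (V W : normedModType R) (L L0 : U -> V) (g : V -> W) :
  linear L0 -> (forall h w u, L (h *: w + u) = h *: L0 w + L u) ->
  differentiable g (L z) ->
  gateaux (fun z' => g (L z')) z (fun w => 'd g (L z) (L0 w)).
Proof.
move=> L0_lin L_affine g_diff; split=> [a u v|w]; first by rewrite L0_lin linearP.
by apply: is_derive_comp_affine.
Qed.

Lemma gateaux_comp (V W : normedModType R) (L : U -> V) (g : V -> W) :
  linear L -> differentiable g (L z) ->
  gateaux (fun z' => g (L z')) z (fun w => 'd g (L z) (L w)).
Proof. by move=> L_lin; apply: gateaux_comp_affine. Qed.

Lemma gateaux_linear (V : normedModType R) (L : U -> V) :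
  linear L -> gateaux L z L.
Proof.
move=> L_lin; have id_diff : differentiable (@idfun V) (L z) by exact: ex_diff.
by have := gateaux_comp L_lin id_diff; rewrite diff_val.
Qed.

Lemma gateaux_cst (V : normedModType R) (c : V) : gateaux (fun=> c) z (fun=> 0).
Proof.
by split=> [a u v|w]; [rewrite scaler0 addr0 | exact: is_derive_cst].
Qed.

Lemma gateauxD (V : normedModType R) (f g df dg : U -> V) :
  gateaux f z df -> gateaux g z dg ->
  gateaux (fun x => f x + g x) z (fun w => df w + dg w).
Proof.
move=> [df_lin f_der] [dg_lin g_der]; split=> [a u v|w]; last exact: is_deriveD.
by rewrite df_lin dg_lin scalerDr addrACA.
Qed.

Lemma gateauxN (V : normedModType R) (f df : U -> V) :
  gateaux f z df -> gateaux (fun x => - f x) z (fun w => - df w).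
Proof.
move=> [df_lin f_der]; split=> [a u v|w]; last exact: is_deriveN.
by rewrite df_lin opprD scalerN.
Qed.

Lemma gateaux_col_mx m1 m2 (f df : U -> 'cV[R]_m1) (g dg : U -> 'cV[R]_m2) :
  gateaux f z df -> gateaux g z dg ->
  gateaux (fun x => col_mx (f x) (g x)) z (fun w => col_mx (df w) (dg w)).
Proof.
move=> [df_lin f_der] [dg_lin g_der].
split=> [a u v|w]; last exact: is_derive_col_mx.
by rewrite df_lin dg_lin scale_col_mx add_col_mx.
Qed.

Lemma gateaux_mulmx m n (A : 'M[R]_(m, n)) (f df : U -> 'cV[R]_n) :
  gateaux f z df -> gateaux (fun x => A *m f x) z (fun w => A *m df w).
Proof.
move=> [df_lin f_der]; split=> [a u v|w]; last exact: is_derive_mulmx.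
by rewrite df_lin linearP.
Qed.
End Gateaux.

Lemma jac_diff (R : realType) m n (g : 'cV[R]_n -> 'cV[R]_m) p u :
  differentiable g p -> jac g p *m u = 'd g p u.
Proof.
move=> g_diff; apply: (jac_gateaux (df := 'd g p)).
exact: (gateaux_comp (L := id)).
Qed.

Lemma dlast_diff (R : realType) (T : normedModType R) n
    (h : T * 'cV[R]_n -> 'cV[R]_n) p u :
  differentiable h p -> dlast h p *m u = 'd h p (0, u).
Proof.
case: p => a b h_diff; apply: (jac_gateaux (df := fun u => 'd h (a, b) (0, u))).
apply: (gateaux_comp_affine (L := pair a) (L0 := pair 0)) => // [c v w|c w v].
  by apply: injective_projections; rewrite //= scaler0 addr0.
by apply: injective_projections; rewrite //= scaler0 add0r.
Qed.

(** * Circulations, loops, potentials and cutsets *)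

Section Graph.
Variables (R : realType) (G : network).
Local Notation node := 'I_(nnodes G).+1.
Local Notation branch := 'I_(nbranches G).
Local Notation A := (incidence G R).

(** Extends the node potentials by 0 at the reference node, which the reduced
    incidence matrix leaves out. *)
Definition potential (e : 'cV[R]_(nnodes G)) (x : node) : R :=
  if unlift (ref G) x is Some i then e i 0 else 0.

(** The inclusion of the branches of type [k] among all branches: multiplying
    by it extends a vector by zero, multiplying by its transpose restricts. *)
Definition selection (k : kind) : 'M[R]_(nbranches G, nb G k) :=
  \matrix_(j, l) (j == enum_val l)%:R.

Lemma incidence_ofE k : incidence_of G R k = A *m selection k.
Proof.
apply/matrixP => x l; rewrite !mxE (bigD1 (enum_val l)) //= big1 => [|j /negPf jl].
  by rewrite !mxE eqxx mulr1 addr0.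
by rewrite !mxE jl mulr0.
Qed.

Lemma selectionE k (u : 'cV[R]_(nb G k)) l :
  (selection k *m u) (enum_val l) 0 = u l 0.
Proof.
rewrite !mxE (bigD1 l) //= big1 => [|l' /negPf ll'].
  by rewrite !mxE eqxx mul1r addr0.
by rewrite !mxE (inj_eq enum_val_inj) eq_sym ll' mul0r.
Qed.

Lemma selection_supp k (u : 'cV[R]_(nb G k)) j :
  (selection k *m u) j 0 != 0 -> type_of j = k.
Proof.
apply: contra_neq_eq => jk; rewrite !mxE big1 // => l _; rewrite !mxE.
case: eqP => [j_l|]; last by rewrite mul0r.
by have := enum_valP l; rewrite -j_l inE (negPf jk).
Qed.

Lemma selectionTE k (i : 'cV[R]_(nbranches G)) l :
  ((selection k)^T *m i) l 0 = i (enum_val l) 0.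
Proof.
rewrite !mxE (bigD1 (enum_val l)) //= big1 => [|j /negPf jl].
  by rewrite !mxE eqxx mul1r addr0.
by rewrite !mxE jl mul0r.
Qed.

Lemma selectionK k (i : 'cV[R]_(nbranches G)) j :
  (selection k *m ((selection k)^T *m i)) j 0 = (type_of j == k)%:R * i j 0.
Proof.
have [jk|] := eqVneq (type_of j) k; last first.
  by apply: contraNeq; rewrite mul0r => /selection_supp ->.
have jb : j \in branches_of G k by rewrite inE jk.
by rewrite mul1r -(enum_rankK_in jb jb) selectionE selectionTE.
Qed.

Lemma incidence_by_kinds (ks : seq kind) (i : 'cV[R]_(nbranches G)) :
  uniq ks -> (forall j, i j 0 != 0 -> type_of j \in ks) ->
  \sum_(k <- ks) incidence_of G R k *m ((selection k)^T *m i) = A *m i.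
Proof.
move=> ks_uniq i_ks.
under eq_bigr do rewrite incidence_ofE -mulmxA.
rewrite -mulmx_sumr; congr (_ *m _); apply/colP => j; rewrite summxE.
under eq_bigr do rewrite selectionK.
have [j0|/i_ks jks] := eqVneq (i j 0) 0.
  by rewrite big1 // => k _; rewrite j0 mulr0.
rewrite (bigD1_seq (type_of j)) //= eqxx mul1r big1 ?addr0 // => k /negPf kj.
by rewrite eq_sym kj mul0r.
Qed.

Lemma potential_drop e j :
  (A^T *m e) j 0 = potential e (src j) - potential e (dst j).
Proof.
have potE x : potential e x = \sum_l (x == lift (ref G) l)%:R * e l 0.
  rewrite /potential; case: unliftP => [l ->|->].
    rewrite (bigD1 l) //= eqxx mul1r big1 ?addr0 // => l' /negPf ll'.
    by rewrite (inj_eq lift_inj) eq_sym ll' mul0r.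
  by rewrite big1 // => l _; rewrite (negPf (neq_lift _ _)) mul0r.
rewrite !potE -sumrB mxE; apply: eq_bigr => l _.
by rewrite !mxE mulrBl.
Qed.

Lemma incidence_of_trE k e :
  (incidence_of G R k)^T *m e = 0 <->
  (forall j, type_of j = k -> potential e (src j) = potential e (dst j)).
Proof.
have E l : ((incidence_of G R k)^T *m e) l 0 =
    potential e (src (enum_val l)) - potential e (dst (enum_val l)).
  by rewrite incidence_ofE trmx_mul -mulmxA selectionTE potential_drop.
split=> [Ae0 j jk|pot_eq].
  have jb : j \in branches_of G k by rewrite inE jk.
  have := E (enum_rank_in jb j); rewrite Ae0 mxE enum_rankK_in // => /esym.
  exact: subr0_eq.
apply/colP => l; rewrite E [RHS]mxE pot_eq ?subrr //.
by have := enum_valP l; rewrite inE => /eqP.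
Qed.

(** The law also holds at the reference node, since every branch leaves one node
    and enters one node, so that the sum of the laws over all nodes is trivial. *)
Lemma current_law (i : 'cV[R]_(nbranches G)) x : A *m i = 0 ->
  \sum_j ((src j == x)%:R - (dst j == x)%:R) * i j 0 = 0.
Proof.
move=> Ai0.
have lifted l : \sum_j ((src j == lift (ref G) l)%:R
                         - (dst j == lift (ref G) l)%:R) * i j 0 = 0.
  have : (A *m i) l 0 = 0 by rewrite Ai0 mxE.
  by rewrite mxE; under eq_bigr do rewrite mxE.
case: (unliftP (ref G) x) => [l ->|->]; first exact: lifted.
have total :
    \sum_(y : node) \sum_j ((src j == y)%:R - (dst j == y)%:R) * i j 0 = 0.
  rewrite exchange_big big1 //= => j _; rewrite -mulr_suml sumrB.
  have one y : \sum_(x : node) (y == x)%:R = 1 :> R.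
    rewrite (bigD1 y) //= eqxx big1 ?addr0 // => y' /negPf.
    by rewrite eq_sym => ->.
  by rewrite !one subrr mul0r.
by move: total; rewrite (bigD1_ord (ref G)) //= [X in _ + X]big1 ?addr0.
Qed.

Definition opposite (j : branch) (x : node) : node :=
  if src j == x then dst j else src j.

(** Walk along branches carrying current. A branch that is not a self-loop
    brings a nonzero current to its far end, so the current law there provides
    another branch to leave by. The walk must come back to a node already
    visited, and a shortest closed stretch is a loop. *)
Lemma loop_of_circulation (i : 'cV[R]_(nbranches G)) :
  A *m i = 0 -> i != 0 ->
  exists2 S, is_loop S & forall j, j \in S -> i j 0 != 0.
Proof.
move=> Ai0 /eqP i_neq0.
have {i_neq0} [j0 ij0] : exists j, i j 0 != 0.
  apply: contrapT => /forallNP i0; apply: i_neq0; apply/colP => j; rewrite mxE.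
  by apply/eqP; apply: contrapT => /negP; apply: i0.
have [[j ij /eqP j_self]|no_self] :=
    pselect (exists2 j, i j 0 != 0 & src j == dst j).
  exists [set j]; last by move=> j'; rewrite inE => /eqP ->.
  exists [:: (src j, j)]; split=> //=; first by rewrite /joins /= -j_self eqxx.
  by apply/setP => j'; rewrite !inE.
have src_dst j : i j 0 != 0 -> src j != dst j.
  by move=> ij; apply/negP => j_self; apply: no_self; exists j.
(* A state of the walk is a node together with the branch by which to leave. *)
pose live (p : node * branch) :=
  (i p.2 0 != 0) && ((src p.2 == p.1) || (dst p.2 == p.1)).
pose next (p : node * branch) :=
  let y := opposite p.2 p.1 in
  (y, odflt p.2 [pick j | (j != p.2) && live (y, j)]).
have nextP p : live p ->
    [/\ live (next p), (next p).2 != p.2 & joins p.2 p.1 (next p).1].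
  case: p => x j /andP[/= ij xj].
  have y_j : ((src j == opposite j x)%:R
              - (dst j == opposite j x)%:R : R) * i j 0 != 0.
    rewrite mulf_neq0 // /opposite; have := src_dst j ij.
    case: (src j == x).
      by rewrite eqxx => /negPf ->; rewrite sub0r oppr_eq0 oner_eq0.
    by rewrite eqxx eq_sym => /negPf ->; rewrite subr0 oner_eq0.
  have x_y : joins j x (opposite j x).
    rewrite /joins /opposite; case/orP: xj => [-> //|/eqP <-]; first by rewrite eqxx.
    by case: ifP => [/eqP <-|_]; rewrite !eqxx ?orbT.
  rewrite /next /=; case: pickP => [j' /andP[j'j j'_live]|no_j'] //.
  case/eqP: y_j; have := current_law (opposite j x) Ai0.
  rewrite (bigD1 j) //= big1 ?addr0 // => j' j'j.
  have := no_j' j'; rewrite j'j /live /= => /negbT; rewrite negb_and negbK negb_or.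
  by case/orP=> [/eqP ->|/andP[/negPf -> /negPf ->]]; rewrite ?mulr0 // subrr mul0r.
have live_iter n p : live p -> live (iter n next p).
  by move=> p_live; elim: n => //= n /nextP[].
pose p0 := (src j0, j0).
have p0_live : live p0 by rewrite /live /= ij0 eqxx.
pose returns n := (0 < n)%N && [exists p, live p && ((iter n next p).1 == p.1)].
have ex_returns : exists n, returns n.
  have [[a [b [a_b ab]]]|no_repeat] := pselect (exists a b,
      (a < b)%N /\ (iter a next p0).1 = (iter b next p0).1).
    exists (b - a)%N; rewrite /returns subn_gt0 a_b; apply/existsP.
    by exists (iter a next p0); rewrite live_iter // -iterD subnK 1?ltnW // ab eqxx.
  have inj : injective (fun k : 'I_(nnodes G).+2 => (iter k next p0).1).
    move=> a b ab; apply: val_inj => /=; apply: contrapT => /eqP; rewrite neq_ltn.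
    by case/orP=> lt; apply: no_repeat; [exists a, b | exists b, a].
  by have := leq_card _ inj; rewrite !card_ord ltnn.
have {ex_returns} [n /andP[n_gt0 /existsP[p /andP[p_live /eqP p_back]]] n_min] :=
  ex_minnP ex_returns.
have nodes_distinct a b :
    (a < b < n)%N -> (iter a next p).1 != (iter b next p).1.
  case/andP=> a_b b_n; apply/negP => /eqP ab.
  suff /n_min : returns (b - a)%N.
    by rewrite leqNgt (leq_ltn_trans (leq_subr _ _) b_n).
  rewrite /returns subn_gt0 a_b; apply/existsP.
  by exists (iter a next p); rewrite live_iter // -iterD subnK 1?ltnW // ab eqxx.
(* If a branch is used at steps a < b, then step b starts at its other end, that
   is, at the node of step a.+1. Hence b = a.+1, but consecutive branches
   differ. *)
have branches_distinct a b :
    (a < b < n)%N -> (iter a next p).2 != (iter b next p).2.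
  move=> ab; have := nodes_distinct a b ab; case/andP: ab => a_b b_n.
  have [_ next_neq joins_a] := nextP _ (live_iter a p p_live).
  have /andP[_ b_inc] := live_iter b p p_live.
  move=> x_neq; apply/negP => /eqP j_eq.
  have x_b : (iter a.+1 next p).1 = (iter b next p).1.
    move: joins_a b_inc x_neq; rewrite -j_eq /joins iterS.
    by case/orP=> /andP[/eqP <- /eqP <-] /orP[] /eqP ->; rewrite ?eqxx.
  have [a1_b|b_a1] := ltnP a.+1 b.
    by have := nodes_distinct a.+1 b; rewrite a1_b b_n x_b eqxx => /(_ isT).
  have b_eq : b = a.+1 by apply/eqP; rewrite eqn_leq b_a1 a_b.
  by move: next_neq; rewrite j_eq b_eq eqxx.
pose s := traject next p n.
have nth_s k : (k < n)%N -> nth p s k = iter k next p.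
  by move=> k_n; rewrite nth_traject.
have size_s : size s = n by rewrite size_traject.
exists [set j in unzip2 s]; last first.
  move=> j; rewrite inE => /mapP[q /trajectP[k k_n ->] ->].
  by case/andP: (live_iter k p p_live).
exists s; split=> //.
- by rewrite -size_eq0 size_s -lt0n.
- apply/negPn/negP => /(uniqPn p.1) [a [b []]]; rewrite size_map size_s => a_b b_n.
  rewrite !(nth_map p) ?size_s ?(ltn_trans a_b) // !nth_s ?(ltn_trans a_b) // => /eqP.
  by apply/negP/nodes_distinct; rewrite a_b.
- apply/negPn/negP => /(uniqPn p.2) [a [b []]]; rewrite size_map size_s => a_b b_n.
  rewrite !(nth_map p) ?size_s ?(ltn_trans a_b) // !nth_s ?(ltn_trans a_b) // => /eqP.
  by apply/negP/branches_distinct; rewrite a_b.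
- have walk m q : live q ->
      path (fun p q => joins p.2 p.1 q.1) q (traject next (next q) m).
    elim: m q => // m IH q /nextP[nq_live _ q_nq].
    by apply/andP; split; [exact: q_nq | exact: IH].
  have -> : s = p :: traject next (next p) n.-1.
    by rewrite /s -{1}(prednK n_gt0).
  apply: etrans (rcons_path _ _ _ _) _; rewrite walk // last_traject.
  have [_ _] := nextP _ (live_iter n.-1 p p_live).
  by rewrite -iterS prednK // p_back.
Qed.

(** A unit current around the loop: at each node, what one branch brings the next
    one takes away, so the contributions of the branches telescope. *)
Lemma circulation_of_loop S : is_loop S ->
  exists2 i : 'cV[R]_(nbranches G), A *m i = 0
    & i != 0 /\ forall j, i j 0 != 0 -> j \in S.
Proof.
case=> s [s_neq0 _ s_uniq s_cycle ->].
pose sgn (p : node * branch) : R := if src p.2 == p.1 then 1 else -1.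
pose unit_of x : 'cV[R]_(nnodes G) := \col_l (x == lift (ref G) l)%:R.
pose i : 'cV[R]_(nbranches G) := \sum_(p <- s) sgn p *: delta_mx p.2 0.
have step p q : joins p.2 p.1 q.1 ->
    A *m (sgn p *: delta_mx p.2 0) = unit_of p.1 - unit_of q.1.
  move=> pq; apply/colP => l.
  rewrite -scalemxAr mxE -colE !mxE /sgn.
  move: pq; rewrite /joins; case: ifP => [/eqP <-|p_src].
    by rewrite mul1r /= => /orP[/eqP <-|/andP[/eqP <- /eqP ->]].
  by rewrite /= => /andP[/eqP -> /eqP ->]; rewrite mulN1r opprB.
have path_sum p t : path (fun p q => joins p.2 p.1 q.1) p t ->
    A *m (\sum_(q <- belast p t) sgn q *: delta_mx q.2 0)
    = unit_of p.1 - unit_of (last p t).1.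
  elim: t p => [|q t IH] p /=; first by rewrite big_nil mulmx0 subrr.
  by case/andP=> /step pq /IH qt; rewrite big_cons mulmxDr pq qt addrA subrK.
have i_supp j : i j 0 != 0 -> j \in [set j in unzip2 s].
  apply: contra_neqT; rewrite inE => j_s; rewrite summxE big_seq big1 // => q q_s.
  rewrite !mxE; have [jq|] := eqVneq j q.2; last by rewrite mulr0.
  by case/negP: j_s; rewrite jq map_f.
case s_eq: s s_neq0 => [//|p t] _.
exists i.
  have := path_sum p (rcons t p).
  rewrite belast_rcons last_rcons subrr /i s_eq; apply.
  by move: s_cycle; rewrite s_eq.
split; last by move=> j /i_supp; rewrite s_eq.
apply/eqP => i0.
(* The branches of a loop are distinct, so that of [p] carries [sgn p] only. *)
have : i p.2 0 = sgn p.
  rewrite /i s_eq big_cons mxE summxE big_seq big1 => [|q q_t].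
    by rewrite !mxE !eqxx mulr1 addr0.
  move: s_uniq; rewrite s_eq !mxE => /andP[p_t _].
  have [pq|] := eqVneq p.2 q.2; last by rewrite mulr0.
  by case/negP: p_t; rewrite pq map_f.
rewrite i0 mxE => /esym/eqP; rewrite /sgn.
by case: ifP => _; rewrite ?oppr_eq0 oner_eq0.
Qed.

Definition adjacent_by (S : {set branch}) : rel node :=
  fun x y => [exists j in S, joins j x y].

Lemma joins_sym (j : branch) x y : joins j x y = joins j y x.
Proof. by rewrite /joins orbC. Qed.

Lemma adjacent_by_sym S : connect_sym (adjacent_by S).
Proof.
apply: sym_connect_sym => x y; apply/existsP/existsP => -[j /andP[jS xy]];
by exists j; rewrite jS joins_sym.
Qed.

Lemma potential_connect e (S : {set branch}) x y :
  (forall j, j \in S -> potential e (src j) = potential e (dst j)) ->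
  connect (adjacent_by S) x y -> potential e x = potential e y.
Proof.
move=> S_eq /connectP[t + ->] {y}.
elim: t x => //= y t IH x /andP[/existsP[j /andP[jS xy]] /IH <-].
by move: xy; rewrite /joins => /orP[] /andP[/eqP <- /eqP <-]; rewrite S_eq.
Qed.

Lemma potential_ref e : potential e (ref G) = 0.
Proof. by rewrite /potential unlift_none. Qed.

Lemma potential_lift e l : potential e (lift (ref G) l) = e l 0.
Proof. by rewrite /potential liftK. Qed.

(** The branches across which the potential jumps separate the reference node
    from every node of nonzero potential, so they contain a cutset. *)
Lemma cutset_of_potential e : e != 0 ->
  exists2 S : {set branch}, is_cutset S
    & forall j, j \in S -> potential e (src j) != potential e (dst j).
Proof.
move=> e_neq0.
pose T : {set branch} := [set j | potential e (src j) != potential e (dst j)].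
have T_cut : ~~ connected_by (~: T).
  apply: contra_neqN e_neq0 => T_conn; apply/colP => l.
  rewrite mxE -potential_lift -(potential_ref e).
  apply: (@potential_connect e (~: T)); last first.
    by move/forallP/(_ (lift (ref G) l))/forallP: T_conn; apply.
  by move=> j; rewrite !inE negbK => /eqP.
have [S S_min S_T] :=
  minset_exists (P := fun S => ~~ connected_by (~: S)) T_cut.
by exists S => // j /(fintype.subsetP S_T); rewrite inE.
Qed.

(** The indicator of the nodes cut off from the reference node. *)
Lemma potential_of_cutset S : is_cutset S ->
  exists2 e, e != 0
    & forall j : branch, j \notin S -> potential e (src j) = potential e (dst j).
Proof.
case/minsetP=> S_cut _.
pose e : 'cV[R]_(nnodes G) :=
  \col_l (~~ connect (adjacent_by (~: S)) (ref G) (lift (ref G) l))%:R.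
have eE x : potential e x = (~~ connect (adjacent_by (~: S)) (ref G) x)%:R.
  case: (unliftP (ref G) x) => [l ->|->]; first by rewrite potential_lift mxE.
  by rewrite potential_ref connect0.
exists e => [|j jS].
  apply: contraNneq S_cut => e0.
  have ref_conn x : connect (adjacent_by (~: S)) (ref G) x.
    have /eqP := eE x; rewrite e0 /potential.
    by case: unlift => [l|]; rewrite ?mxE eq_sym pnatr_eq0 eqb0 negbK.
  apply/forallP => x; apply/forallP => y.
  by apply: connect_trans (ref_conn y); rewrite adjacent_by_sym.
rewrite !eE; congr (~~ _)%:R.
apply: (same_connect_r (adjacent_by_sym _)); apply: connect1.
by apply/existsP; exists j; rewrite inE jS /joins !eqxx.
Qed.

Lemma potential_eq0 (e : 'cV[R]_(nnodes G)) :
  ~ has_cutset G [:: Kj] ->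
  (forall k, k != Kj -> (incidence_of G R k)^T *m e = 0) -> e = 0.
Proof.
move=> no_cut e_eq; apply/eqP/negP => /negP/cutset_of_potential[S S_cut S_jump].
apply: no_cut; exists S; split=> // j /S_jump.
apply: contra_neqT; rewrite inE => jk.
by apply: (incidence_of_trE (type_of j) e).1 => //; exact: e_eq.
Qed.

Lemma current_eq0 (u : 'cV[R]_(nb G Ku)) :
  ~ has_loop G [:: Ku] -> incidence_of G R Ku *m u = 0 -> u = 0.
Proof.
move=> no_loop; rewrite incidence_ofE -mulmxA => Au0.
have [u0|u_neq0] := eqVneq (selection Ku *m u) 0.
  by apply/colP => l; rewrite -selectionE u0 !mxE.
have [S S_loop S_supp] := loop_of_circulation Au0 u_neq0.
by case: no_loop; exists S; split=> // j /S_supp/selection_supp ->; rewrite inE.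
Qed.
End Graph.

(** * The linearized circuit *)

(** The quadratic form is the power absorbed by a resistive device, where [u] and
    [h u] are a voltage and a current; for a reactive device, where they are a
    voltage and a charge or a current and a flux, it is an energy. *)
Definition strictly_passive (R : realType) n (h : 'cV[R]_n -> 'cV[R]_n) :=
  h 0 = 0 /\ forall u, u != 0 -> 0 < (u^T *m h u) 0 0.

(** The charges and fluxes that control devices with memory are set to 0, because
    they vanish in all the perturbations that matter to the index. *)
Record passive_devices (R : realType) (G : network) (D : devices R G) : Prop :=
  PassiveDevices {
    passive_c : strictly_passive (gamma_c D);
    passive_l : strictly_passive (gamma_l D);
    passive_r : strictly_passive (gamma_r D);
    passive_g : strictly_passive (gamma_g D);
    passive_m : strictly_passive (fun u => eta D (0, u));
    passive_w : strictly_passive (fun u => zeta D (0, u));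
    passive_mc : strictly_passive (fun u => omega D (0, u));
    passive_ml : strictly_passive (fun u => theta D (0, u));
    passive_hm : strictly_passive (fun u => psi D (0, u));
    passive_hw : strictly_passive (fun u => xi D (0, u));
    quiet_u : forall t, v_s D t = 0;
    quiet_j : forall t, i_s D t = 0
  }.

(** The device maps are replaced by their differentials at the operating point
    [z], whose coordinates are named as in [nodal_rhs]. *)
Definition linearized (R : realType) (G : network) (D : devices R G)
    (z : 'cV[R]_(nx G + ny G)) : devices R G :=
  let A := incidence_of G R in
  let x := usubmx z in
  let q_c := usubmx x in let x1 := dsubmx x in
  let q_mc := usubmx x1 in let x2 := dsubmx x1 in
  let phi_l := usubmx x2 in let x3 := dsubmx x2 in
  let phi_ml := usubmx x3 in let x4 := dsubmx x3 in
  let q_m := usubmx x4 in let x5 := dsubmx x4 in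
  let q_ml := usubmx x5 in let x6 := dsubmx x5 in
  let q_hm := usubmx x6 in let x7 := dsubmx x6 in
  let q_hw := usubmx x7 in let x8 := dsubmx x7 in
  let phi_w := usubmx x8 in let x9 := dsubmx x8 in
  let phi_mc := usubmx x9 in let x10 := dsubmx x9 in
  let phi_hm := usubmx x10 in
  let phi_hw := dsubmx x10 in
  let y := dsubmx z in
  let e := usubmx y in let y1 := dsubmx y in
  let i_c := usubmx y1 in let y2 := dsubmx y1 in
  let i_mc := usubmx y2 in let y3 := dsubmx y2 in
  let i_u := usubmx y3 in let y4 := dsubmx y3 in
  let i_l := usubmx y4 in let y5 := dsubmx y4 in
  let i_ml := usubmx y5 in let y6 := dsubmx y5 in
  let i_r := usubmx y6 in let y7 := dsubmx y6 in
  let i_m := usubmx y7 in let y8 := dsubmx y7 in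
  let i_hm := usubmx y8 in
  let v k := (A k)^T *m e in
  @Devices R G ('d (gamma_c D) (v Kc)) ('d (gamma_l D) i_l)
    ('d (gamma_r D) i_r) ('d (gamma_g D) (v Kg))
    ('d (eta D) (q_m, i_m)) ('d (zeta D) (phi_w, v Kw))
    ('d (omega D) (phi_mc, v Kmc)) ('d (theta D) (q_ml, i_ml))
    ('d (psi D) (q_hm, phi_hm, i_hm)) ('d (xi D) (q_hw, phi_hw, v Khw))
    (fun=> 0) (fun=> 0).

Section Linearization.
Variables (R : realType) (G : network) (D : devices R G).
Hypothesis D_smooth : smooth_devices D.

(** [nodal_rhs] is built from the device maps by linear operations, which commute
    with differentiation. *)
Lemma linearized_rhs z t w :
  jac (fun z' => nodal_rhs D z' t) z *m w = nodal_rhs (linearized D z) w 0.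
Proof.
have [[[C1c _] [C1l _] [C1r _] [C1g _]] [[C1m _] [C1w _] [C1mc _] [C1ml _]]
  [[C1hm _] [C1hw _]] _] := D_smooth.
apply: (jac_gateaux (df := fun w => nodal_rhs (linearized D z) w 0)).
rewrite /nodal_rhs /linearized /=; cbv zeta.
repeat apply: gateaux_col_mx.
all: repeat first
  [apply: gateauxD | apply: gateauxN | apply: gateaux_mulmx | apply: gateaux_cst].
(* What remains is a coordinate of the vector or a device map applied to a tuple of
   coordinates. *)
all: try (by apply: gateaux_linear => a u v; rewrite !linearP).
all: apply: gateaux_comp => // a u v; rewrite !linearP.
all: by repeat apply: injective_projections.
Qed.

Lemma strictly_passive_mulmx n (K : 'M[R]_n) (h : 'cV[R]_n -> 'cV[R]_n) :
  posdef K -> (forall u, K *m u = h u) -> strictly_passive h.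
Proof.
move=> K_pos Kh; split=> [|u u_neq0]; first by rewrite -Kh mulmx0.
by rewrite -Kh mulmxA; exact: K_pos.
Qed.

Lemma linearized_passive z :
  (forall p, posdef (Cmat D p)) -> (forall p, posdef (Cm_mat D p)) ->
  (forall p, posdef (Lmat D p)) -> (forall p, posdef (Lm_mat D p)) ->
  (forall p, posdef (Rmat D p)) -> (forall p, posdef (Gmat D p)) ->
  (forall p, posdef (Mmat D p)) -> (forall p, posdef (Mh_mat D p)) ->
  (forall p, posdef (Wmat D p)) -> (forall p, posdef (Wh_mat D p)) ->
  passive_devices (linearized D z).
Proof.
have [[[C1c _] [C1l _] [C1r _] [C1g _]] [[C1m _] [C1w _] [C1mc _] [C1ml _]]
  [[C1hm _] [C1hw _]] _] := D_smooth.
move=> c mc l ml r g m hm w hw; split=> //=.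
- by apply: strictly_passive_mulmx (c _) _ => u; rewrite jac_diff.
- by apply: strictly_passive_mulmx (l _) _ => u; rewrite jac_diff.
- by apply: strictly_passive_mulmx (r _) _ => u; rewrite jac_diff.
- by apply: strictly_passive_mulmx (g _) _ => u; rewrite jac_diff.
- by apply: strictly_passive_mulmx (m _) _ => u; rewrite dlast_diff.
- by apply: strictly_passive_mulmx (w _) _ => u; rewrite dlast_diff.
- by apply: strictly_passive_mulmx (mc _) _ => u; rewrite dlast_diff.
- by apply: strictly_passive_mulmx (ml _) _ => u; rewrite dlast_diff.
- by apply: strictly_passive_mulmx (hm _) _ => u; rewrite dlast_diff.
- by apply: strictly_passive_mulmx (hw _) _ => u; rewrite dlast_diff.
Qed.
End Linearization.

(** * Energy balance in the linearized circuit *)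

Section Energy.
Variable R : realType.

Definition dot n (u v : 'cV[R]_n) : R := (u^T *m v) 0 0.

Lemma dotC n (u v : 'cV[R]_n) : dot u v = dot v u.
Proof. by rewrite /dot -[u^T *m v]trmxK trmx_mul trmxK mxE. Qed.

Lemma dotDr n (u v w : 'cV[R]_n) : dot u (v + w) = dot u v + dot u w.
Proof. by rewrite /dot mulmxDr mxE. Qed.

Lemma dotNr n (u v : 'cV[R]_n) : dot u (- v) = - dot u v.
Proof. by rewrite /dot mulmxN mxE. Qed.

Lemma dot_mulmx m n (A : 'M[R]_(m, n)) u v : dot u (A *m v) = dot (A^T *m u) v.
Proof. by rewrite /dot trmx_mul trmxK mulmxA. Qed.

Lemma dot0r n (u : 'cV[R]_n) : dot u 0 = 0.
Proof. by rewrite /dot mulmx0 mxE. Qed.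

Lemma dot0l n (u : 'cV[R]_n) : dot 0 u = 0.
Proof. by rewrite dotC dot0r. Qed.

Variables (n : nat) (h : 'cV[R]_n -> 'cV[R]_n).
Hypothesis h_passive : strictly_passive h.

Lemma passive_ge0 u : 0 <= dot u (h u).
Proof.
have [->|u_neq0] := eqVneq u 0; first by rewrite dot0l.
by apply: ltW; case: h_passive => _; apply.
Qed.

Lemma passive_dot_eq0 u : dot u (h u) = 0 -> u = 0.
Proof.
move=> hu0; apply/eqP; apply: contraT => u_neq0.
by case: h_passive => _ /(_ u u_neq0); rewrite -/(dot _ _) hu0 ltxx.
Qed.

Lemma passive_eq0 u : h u = 0 -> u = 0.
Proof. by move=> hu0; apply: passive_dot_eq0; rewrite hu0 dot0r. Qed.
End Energy.

Section LinearizedCircuit.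
Variables (R : realType) (G : network).
Local Notation A := (incidence_of G R).

Definition algebraic_vector (e : 'cV[R]_(nnodes G)) (i_c : 'cV[R]_(nb G Kc))
    (i_mc : 'cV[R]_(nb G Kmc)) (i_u : 'cV[R]_(nb G Ku)) (i_l : 'cV[R]_(nb G Kl))
    (i_ml : 'cV[R]_(nb G Kml)) (i_r : 'cV[R]_(nb G Kr)) (i_m : 'cV[R]_(nb G Km))
    (i_hm : 'cV[R]_(nb G Khm)) (i_hw : 'cV[R]_(nb G Khw)) : 'cV[R]_(ny G) :=
  col_mx e (col_mx i_c (col_mx i_mc (col_mx i_u (col_mx i_l (col_mx i_ml
    (col_mx i_r (col_mx i_m (col_mx i_hm i_hw)))))))).

Lemma algebraic_vectorP (y : 'cV[R]_(ny G)) :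
  exists e i_c i_mc i_u i_l i_ml i_r i_m i_hm i_hw,
    y = algebraic_vector e i_c i_mc i_u i_l i_ml i_r i_m i_hm i_hw.
Proof.
do 10!eexists; rewrite /algebraic_vector.
by do 9!(rewrite -[LHS]vsubmxK; congr col_mx).
Qed.

Variable D : devices R G.
Hypothesis D_passive : passive_devices D.
Local Notation Fyy y := (dsubmx (nodal_rhs D (col_mx 0 y) 0)).

Lemma algebraic_equations e i_c i_mc i_u i_l i_ml i_r i_m i_hm i_hw :
  let v k := (A k)^T *m e in
  Fyy (algebraic_vector e i_c i_mc i_u i_l i_ml i_r i_m i_hm i_hw) =
  col_mx (A Kc *m i_c + A Kmc *m i_mc + A Ku *m i_u + A Kl *m i_l
          + A Kml *m i_ml + A Kg *m gamma_g D (v Kg)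
          + A Kw *m zeta D (0, v Kw) + A Kr *m i_r + A Km *m i_m
          + A Khm *m i_hm + A Khw *m i_hw)
  (col_mx (- gamma_c D (v Kc)) (col_mx (- omega D (0, v Kmc)) (col_mx (- v Ku)
  (col_mx (- gamma_l D i_l) (col_mx (- theta D (0, i_ml))
  (col_mx (gamma_r D i_r - v Kr) (col_mx (eta D (0, i_m) - v Km)
  (col_mx (psi D (0, i_hm) - v Khm) (i_hw - xi D (0, v Khw)))))))))).
Proof.
rewrite /nodal_rhs /algebraic_vector /=; cbv zeta.
rewrite !(col_mxKu, col_mxKd) !linear0 !sub0r.
by rewrite quiet_j // quiet_u // mulmx0 addr0 sub0r.
Qed.

(** Nonsingularity of the reactive devices makes the capacitive voltages and the
    inductive currents vanish. Multiplying the current law by the transposed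
    potentials then leaves a vanishing sum of the powers absorbed by the
    resistive devices, each of which is nonnegative. *)
Lemma algebraic_kernel e i_c i_mc i_u i_l i_ml i_r i_m i_hm i_hw :
  Fyy (algebraic_vector e i_c i_mc i_u i_l i_ml i_r i_m i_hm i_hw) = 0 <->
  [/\ A Kc *m i_c + A Kmc *m i_mc + A Ku *m i_u = 0,
      forall k, k \notin [:: Kj; Kl; Kml] -> (A k)^T *m e = 0,
      i_l = 0 /\ i_ml = 0
    & [/\ i_r = 0, i_m = 0, i_hm = 0 & i_hw = 0]].
Proof.
case: D_passive => pc pl pr pg pm pw pmc pml phm phw _ _.
rewrite algebraic_equations; split; last first.
  move=> [kcl v0 [-> ->] [-> -> -> ->]].
  rewrite !v0 //.
  rewrite !(pc.1, pl.1, pr.1, pg.1, pm.1, pw.1, pmc.1, pml.1, phm.1, phw.1).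
  rewrite !mulmx0 !addr0 !subr0 !oppr0 kcl.
  by rewrite !col_mx0.
move/eqP; rewrite !col_mx_eq0 !oppr_eq0 !subr_eq0.
case/and5P=> /eqP kcl /eqP/(passive_eq0 pc) vc /eqP/(passive_eq0 pmc) vmc /eqP vu.
case/and5P=> /eqP/(passive_eq0 pl) il /eqP/(passive_eq0 pml) iml /eqP vr /eqP vm.
case/andP=> /eqP vhm /eqP ihw.
have := congr1 (dot e) kcl.
rewrite il iml !dotDr !dot_mulmx vc vmc vu -vr -vm -vhm ihw !dot0l !dot0r !add0r.
rewrite (dotC _ i_r) (dotC _ i_m) (dotC _ i_hm).
have := passive_ge0 pg ((A Kg)^T *m e).
have := passive_ge0 pw ((A Kw)^T *m e).
have := passive_ge0 phw ((A Khw)^T *m e).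
have := passive_ge0 pr i_r; have := passive_ge0 pm i_m.
have := passive_ge0 phm i_hm.
move=> hm0 m0 r0 hw0 w0 g0 total.
have {hm0 m0 r0 hw0 w0 g0 total} [] :
    [/\ dot i_r (gamma_r D i_r) = 0, dot i_m (eta D (0, i_m)) = 0,
        dot i_hm (psi D (0, i_hm)) = 0,
        dot ((A Kg)^T *m e) (gamma_g D ((A Kg)^T *m e)) = 0
      & dot ((A Kw)^T *m e) (zeta D (0, (A Kw)^T *m e)) = 0 /\
        dot ((A Khw)^T *m e) (xi D (0, (A Khw)^T *m e)) = 0].
  by do !split; lra.
move=> /(passive_dot_eq0 pr) ir /(passive_dot_eq0 pm) im.
move=> /(passive_dot_eq0 phm) ihm /(passive_dot_eq0 pg) vg.
move=> [/(passive_dot_eq0 pw) vw /(passive_dot_eq0 phw) vhw].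
split; last 1 first.
- by split=> //; rewrite vhw phw.1.
- by rewrite -kcl il iml ir im ihm ihw vg vw vhw pg.1 pw.1 phw.1 !mulmx0 !addr0.
- by case=> // _; rewrite -1?vr -1?vm -1?vhm ?ir ?im ?ihm ?pr.1 ?pm.1 ?phm.1.
- by [].
Qed.

Lemma dynamic_equations e i_c i_mc i_u i_l i_ml i_r i_m i_hm i_hw :
  let v k := (A k)^T *m e in
  usubmx (nodal_rhs D
    (col_mx 0 (algebraic_vector e i_c i_mc i_u i_l i_ml i_r i_m i_hm i_hw)) 0) =
  col_mx i_c (col_mx i_mc (col_mx (v Kl) (col_mx (v Kml)
  (col_mx i_m (col_mx i_ml (col_mx i_hm (col_mx i_hw
  (col_mx (v Kw) (col_mx (v Kmc) (col_mx (v Khm) (v Khw))))))))))).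
Proof.
rewrite /nodal_rhs /algebraic_vector /=; cbv zeta.
by rewrite !(col_mxKu, col_mxKd).
Qed.

(** The remaining dynamic variables are 0 because Fxy maps ker Fyy into the
    vectors of this form. *)
Lemma dynamic_coupling q_c q_mc phi_l phi_ml :
  let x := col_mx q_c (col_mx q_mc (col_mx phi_l (col_mx phi_ml 0))) in
  dsubmx (nodal_rhs D (col_mx x 0) 0) =
  col_mx 0 (col_mx q_c (col_mx q_mc
    (col_mx 0 (col_mx phi_l (col_mx phi_ml 0))))).
Proof.
case: D_passive => pc pl pr pg pm pw pmc pml phm phw qu qj x.
rewrite /x /nodal_rhs /=; cbv zeta.
rewrite !(col_mxKu, col_mxKd) !linear0 ?addr0 qu qj.
rewrite pc.1 pl.1 pr.1 pg.1 pm.1 pw.1 pmc.1 pml.1 phm.1 phw.1.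
by rewrite !mulmx0 !addr0 !subr0 !col_mx0.
Qed.

Hypothesis no_V_loop : ~ has_loop G [:: Ku].
Hypothesis no_I_cutset : ~ has_cutset G [:: Kj].

(** Let e and i be the potentials and currents of [y], and e' and i' those of [u].
    The currents i_c and i_mc are minus the responses of the capacitors to the
    voltages of e', and together with i_u they satisfy the current law. As e'
    has no voltage across the sources, pairing this law with e' gives minus the
    energy of the capacitors under e', which must then be 0. Dually, the
    voltages of e across the inductors are minus the responses of the inductors
    to i', and e has no voltage elsewhere, except across current sources, so
    pairing the current law of [u] with e gives minus the energy of the
    inductors under i'. *)
Lemma transversality y u :
  Fyy y = 0 ->
  dsubmx (nodal_rhs D (col_mx (usubmx (nodal_rhs D (col_mx 0 y) 0)) 0) 0)
    = Fyy u ->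
  y = 0.
Proof.
have [e [i_c [i_mc [i_u [i_l [i_ml [i_r [i_m [i_hm [i_hw ->]]]]]]]]]] :=
  algebraic_vectorP y.
have [e' [i_c' [i_mc' [i_u' [i_l' [i_ml' [i_r' [i_m' [i_hm' [i_hw' ->]]]]]]]]]] :=
  algebraic_vectorP u.
case/algebraic_kernel=> kcl v0 [-> ->] [-> -> -> ->].
case: D_passive => pc pl _ _ _ _ pmc pml _ _ _ _.
have [vw vmc vhm vhw] : [/\ (A Kw)^T *m e = 0, (A Kmc)^T *m e = 0,
    (A Khm)^T *m e = 0 & (A Khw)^T *m e = 0] by split; apply: v0.
rewrite dynamic_equations vw vmc vhm vhw !col_mx0.
rewrite [X in X = _ -> _]dynamic_coupling [X in _ = X -> _]algebraic_equations.
case/eq_col_mx=> kcl' /eq_col_mx[def_ic] /eq_col_mx[def_imc] /eq_col_mx[def_vu'].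
case/eq_col_mx=> def_vl /eq_col_mx[def_vml _].
have energy_c : dot ((A Kc)^T *m e') (gamma_c D ((A Kc)^T *m e')) = 0 /\
    dot ((A Kmc)^T *m e') (omega D (0, (A Kmc)^T *m e')) = 0.
  have vu' : (A Ku)^T *m e' = 0 by apply/eqP; rewrite -oppr_eq0 -def_vu'.
  have := congr1 (dot e') kcl.
  rewrite !dotDr !dot_mulmx vu' dot0l dot0r def_ic def_imc !dotNr.
  have := passive_ge0 pc ((A Kc)^T *m e').
  have := passive_ge0 pmc ((A Kmc)^T *m e').
  by split; lra.
have [i_c0 i_mc0] : i_c = 0 /\ i_mc = 0.
  case: energy_c => /(passive_dot_eq0 pc) vc' /(passive_dot_eq0 pmc) vmc'.
  by rewrite def_ic def_imc vc' vmc' pc.1 pmc.1 !oppr0.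
have i_u0 : i_u = 0.
  apply: current_eq0 no_V_loop _; move: kcl.
  by rewrite i_c0 i_mc0 !mulmx0 !add0r.
have energy_l : dot i_l' (gamma_l D i_l') = 0 /\
    dot i_ml' (theta D (0, i_ml')) = 0.
  have := congr1 (dot e) kcl'.
  rewrite !dotDr !dot_mulmx vmc vw vhm vhw.
  rewrite !(v0 Kc, v0 Ku, v0 Kg, v0 Kr, v0 Km) //.
  rewrite !dot0l !dot0r !add0r !addr0 def_vl def_vml.
  rewrite [X in 0 = X + _ -> _]dotC [X in 0 = _ + X -> _]dotC !dotNr.
  have := passive_ge0 pl i_l'; have := passive_ge0 pml i_ml'.
  by split; lra.
have e0 : e = 0.
  apply: potential_eq0 no_I_cutset _ => k k_j.
  have [k_l|k_nl] := boolP (k \in [:: Kl; Kml]); last first.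
    by apply: v0; rewrite inE negb_or k_j.
  case: energy_l => /(passive_dot_eq0 pl) il' /(passive_dot_eq0 pml) iml'.
  move: k_l; rewrite !inE => /orP[] /eqP ->.
    by rewrite def_vl il' pl.1 oppr0.
  by rewrite def_vml iml' pml.1 oppr0.
by rewrite /algebraic_vector e0 i_c0 i_mc0 i_u0 !col_mx0.
Qed.

(** A loop gives circulating currents without potentials, a cutset gives potentials
    without currents. *)
Lemma degenerate_kernel :
  has_loop G [:: Ku; Kc; Kmc] \/ has_cutset G [:: Kj; Kl; Kml] ->
  exists2 y, y != 0 & Fyy y = 0.
Proof.
case=> [[S [S_loop S_kinds]]|[S [S_cut S_kinds]]].
  have [i Ai0 [i_neq0 i_S]] := circulation_of_loop R S_loop.
  have i_kinds j : i j 0 != 0 -> type_of j \in [:: Kc; Kmc; Ku].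
    by move=> /i_S/S_kinds; rewrite !inE; case: (type_of j).
  have := incidence_by_kinds (ks := [:: Kc; Kmc; Ku]) isT i_kinds.
  rewrite !big_cons big_nil addr0 Ai0 addrA => kcl.
  pose i_ k := (selection R G k)^T *m i.
  exists (algebraic_vector 0 (i_ Kc) (i_ Kmc) (i_ Ku) 0 0 0 0 0 0).
    apply: contraNneq i_neq0 => /eqP.
    rewrite !col_mx_eq0 => /and5P[_ /eqP ic /eqP imc /eqP iu _].
    apply/eqP/colP => j; rewrite [RHS]mxE; apply/eqP; apply: contraT => ij.
    have := selectionK (type_of j) i j; rewrite eqxx mul1r.
    have -> : (selection R G (type_of j))^T *m i = 0.
      by move: (i_kinds j ij); rewrite !inE => /or3P[] /eqP ->.
    by rewrite mulmx0 mxE => /esym/eqP; rewrite (negPf ij).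
  by apply/algebraic_kernel; split=> // k _; rewrite mulmx0.
have [e e_neq0 e_S] := potential_of_cutset R S_cut.
exists (algebraic_vector e 0 0 0 0 0 0 0 0 0).
  by apply: contraNneq e_neq0 => /eqP; rewrite !col_mx_eq0 => /andP[].
apply/algebraic_kernel; split=> //; first by rewrite !mulmx0 !addr0.
move=> k k_ok; apply/incidence_of_trE => j jk; apply: e_S.
by apply: contra k_ok => /S_kinds; rewrite jk.
Qed.
End LinearizedCircuit.

(** * The index of the nodal model *)

Theorem theorem2 (R : realType) (G : network) (D : devices R G)
  (G_connected : connected_network G)
  (no_V_loop : ~ has_loop G [:: Ku])
  (no_I_cutset : ~ has_cutset G [:: Kj])
  (D_smooth : smooth_devices D)
  (D_genuine : genuine_devices D)
  (C_posdef : forall v_c, posdef (Cmat D v_c))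
  (Cm_posdef : forall p, posdef (Cm_mat D p))
  (L_posdef : forall i_l, posdef (Lmat D i_l))
  (Lm_posdef : forall p, posdef (Lm_mat D p))
  (R_posdef : forall i_r, posdef (Rmat D i_r))
  (G_posdef : forall v_g, posdef (Gmat D v_g))
  (M_posdef : forall p, posdef (Mmat D p))
  (Mh_posdef : forall p, posdef (Mh_mat D p))
  (W_posdef : forall p, posdef (Wmat D p))
  (Wh_posdef : forall p, posdef (Wh_mat D p))
  (degenerate : has_loop G [:: Ku; Kc; Kmc] \/ has_cutset G [:: Kj; Kl; Kml]) :
  tractability_index_two (nodal_E R G) (nodal_rhs D).
Proof.
have lin_passive z : passive_devices (linearized D z).
  exact: linearized_passive.
pose df z (t : R) w := nodal_rhs (linearized D z) w 0.
apply: (semiexplicit_index_two (df := df)).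
- by move=> z t w; exact: linearized_rhs.
- move=> z t z' t' y.
  have [e [i_c [i_mc [i_u [i_l [i_ml [i_r [i_m [i_hm [i_hw ->]]]]]]]]]] :=
    algebraic_vectorP y.
  apply: etrans (dynamic_equations (linearized D z) _ _ _ _ _ _ _ _ _ _) _.
  exact: esym (dynamic_equations _ _ _ _ _ _ _ _ _ _ _).
- move=> z t z' t' y.
  have [e [i_c [i_mc [i_u [i_l [i_ml [i_r [i_m [i_hm [i_hw ->]]]]]]]]]] :=
    algebraic_vectorP y.
  move/(algebraic_kernel (lin_passive z)) => y_ker.
  exact/(algebraic_kernel (lin_passive z')).
- exact: degenerate_kernel (lin_passive 0) degenerate.
- move=> z t y u.
  exact: transversality (lin_passive z) no_V_loop no_I_cutset y u.
Qed.
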